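(* Let $a_n\in\mathbb{C}$ ($0\ne n\in\mathfrak{O}$) be arbitrary. Then, for $X,Y\ge1$, $Q,N>0$ and $t\in\mathbb{R}$, one has $$S_t(Q,X,N)\le\max\bigl\{1,(X/Y)^{\vartheta}\bigr\}\,S_t(Q,Y,N).$$
   Context: Notation. $\mathfrak{O}=\mathbb{Z}[i]$; summation variables range over all elements of $\mathfrak{O}$ satisfying the stated conditions, unless otherwise indicated; $\mathrm{e}(x)=\exp(2\pi i x)$. $G=SL(2,\mathbb{C})$, $K=SU(2)$, $n[z]=\begin{pmatrix}1&z\\0&1\end{pmatrix}$ ($z\in\mathbb{C}$), $a[r]=\begin{pmatrix}\sqrt r&0\\0&1/\sqrt r\end{pmatrix}$ ($r>0$); each $g\in G$ is uniquely $n[z]a[r]k$ with $k\in K$. Haar measure: $dg=r^{-3}\,dx\,dy\,dr\,dk$ for $g=n[x+iy]a[r]k$, where $dk$ is the Haar measure on $K$ of total mass $2$. For $0\ne q\in\mathfrak{O}$, $\Gamma_0(q)=\{\begin{pmatrix}a&b\\c&d\end{pmatrix}\in SL(2,\mathfrak{O}):c\in q\mathfrak{O}\}$. Let $\Gamma=\Gamma_0(q)$. $L^2(\Gamma\backslash G)$ is the Hilbert space of measurable $f:G\to\mathbb{C}$ with $f(\gamma g)=f(g)$ ($\gamma\in\Gamma$) and $\|f\|^2_{\Gamma\backslash G}=\int_{\mathcal{F}}|f(g)|^2dg<\infty$, $\mathcal{F}$ being a fundamental domain for the left action of $\Gamma$ on $G$. The cusps of $\Gamma$ are the points of $\mathbb{Q}(i)\cup\{\infty\}$.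 For a cusp $\mathfrak{c}$, $\Gamma'_{\mathfrak{c}}=\{\gamma\in\Gamma:\gamma\mathfrak{c}=\mathfrak{c},\ \mathrm{Tr}(\gamma)=2\}$, and $g_{\mathfrak{c}}\in G$ is a scaling matrix: $g_{\mathfrak{c}}\infty=\mathfrak{c}$ and $g_{\mathfrak{c}}^{-1}\Gamma'_{\mathfrak{c}}g_{\mathfrak{c}}=\{n[\alpha]:\alpha\in\mathfrak{O}\}$; for $\mathfrak{c}=\infty$ we take $g_\infty$ to be the identity matrix. The cuspidal subspace ${}^0L^2(\Gamma\backslash G)$ (closure of the span of cusp forms, i.e. the $f\in L^2(\Gamma\backslash G)$ with $\int_{\mathbb{C}/\mathfrak{O}}f(g_{\mathfrak{c}}n[z]g)\,dx\,dy=0$ ($z=x+iy$) for almost all $g$ and every cusp $\mathfrak{c}$) is the closure of an orthogonal direct sum of countably many closed subspaces $V$ that are invariant and irreducible under right translation by $G$; fix such a decomposition. Each $V$ has spectral parameters $(\nu_V,p_V)\in(i[0,\infty)\times\mathbb{Z})\cup((0,1)\times\{0\})$. The $V$ with $\nu_V>0$ (which have $p_V=0$, and are finite in number for each $\Gamma$) are exactly those containing a nonzero right $K$-invariant function $f_V$ (unique up to scalars) with $-\mathbf{\Delta}f_V=\lambda_Vf_V$ and $0<\lambda_V<1$, where $\mathbf{\Delta}=r^2(\partial_x^2+\partial_y^2+\partial_r^2)-r\partial_r$; then $\nu_V=\sqrt{1-\lambda_V}$. For such $V$, $f_V$ is normalised by $\|f_V\|^2_{\Gamma\backslash G}=2\,\Gamma(1-\nu_V)/\Gamma(1+\nu_V)$,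 and its Fourier coefficients $c_V^{\infty}(\omega)$ at $\infty$ are defined by $$f_V(n[z]a[r]k)=\sum_{0\neq\omega\in\mathfrak{O}}c_V^{\infty}(\omega)\,\frac{2\pi^{1+\nu_V}|\omega|^{\nu_V}}{\Gamma(1+\nu_V)}\,\mathrm{e}(\mathrm{Re}(\omega z))\,r\,K_{\nu_V}(2\pi|\omega|r),$$ with $K_\nu$ the modified Bessel function of the second kind. The modified coefficient is $c_V^{\infty}(\omega;\nu_V,0)=(\pi|\omega|)^{\nu_V}c_V^{\infty}(\omega)$. The notation $\sum_{V:\nu_V>0}^{(\Gamma)}$ means summation over the $V$ in the decomposition for $\Gamma$ with $\nu_V>0$. For given coefficients $a_n\in\mathbb{C}$ ($0\ne n\in\mathfrak{O}$), $t\in\mathbb{R}$, $Q,N>0$ and $X\ge1$, $$S_t(Q,X,N)=\sum_{Q/2<|q|^2\le Q}\ \sum_{V:\,\nu_V>0}^{(\Gamma_0(q))}X^{\nu_V}\Bigl|\sum_{N/4<|n|^2\le N}a_n|n|^{2it}c_V^\infty(n;\nu_V,0)\Bigr|^2.$$ $\Theta(q)$ is the maximum of $\mathrm{Re}(\nu_V)$ over all $V$ occurring for $\Gamma=\Gamma_0(q)$ (the largest $\nu_V>0$ if there is one, otherwise $0$), and $\vartheta=\sup_{0\ne q\in\mathfrak{O}}\Theta(q)$ (an absolute constant, known by work of Kim and Shahidi to satisfy $0\le\vartheta\le2/9$). *)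

(* Defs.v *)
From HB Require Import structures.
From mathcomp Require Import all_boot all_order all_algebra finmap.
From mathcomp Require Import all_classical all_reals all_analysis.
From mathcomp Require Import measurable_realfun summability.
From mathcomp Require Import complex.

Set Implicit Arguments.
Unset Strict Implicit.
Unset Printing Implicit Defensive.

Import Order.TTheory GRing.Theory Num.Theory.
Import numFieldNormedType.Exports.
Import Normc.

Local Open Scope classical_set_scope.
Local Open Scope ring_scope.
Local Open Scope complex_scope.

Definition mx2 (T : Type) (a b c d : T) : 'M[T]_2 :=
  \matrix_(i, j) if i == 0 then (if j == 0 then a else b)
                 else (if j == 0 then c else d).

Record SL2 (R : realType) :=
  MkSL2 { SL2_mx :> 'M[R[i]]_2 ; SL2_det : \det SL2_mx == 1 }.

HB.instance Definition _ R := [isSub for @SL2_mx R].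
HB.instance Definition _ R := [Choice of SL2 R by <:].

Section group.
Variable R : realType.
Implicit Types g h : SL2 R.

Definition SL2_one : SL2 R := MkSL2  (introT eqP (det1 _ _)).

Lemma SL2_mul_subproof g h : \det (SL2_mx g *m SL2_mx h) == 1.
Proof. by rewrite det_mulmx (eqP (SL2_det g)) (eqP (SL2_det h)) mulr1. Qed.
Definition SL2_mul g h : SL2 R := MkSL2 (SL2_mul_subproof g h).

Lemma SL2_unit g : SL2_mx g \in unitmx.
Proof. by rewrite unitmxE (eqP (SL2_det g)) unitr1. Qed.

Lemma SL2_inv_subproof g : \det (invmx (SL2_mx g)) == 1.
Proof. by rewrite det_inv (eqP (SL2_det g)) invr1. Qed.
Definition SL2_inv g : SL2 R := MkSL2 (SL2_inv_subproof g).

Lemma SL2_mulA : associative SL2_mul.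
Proof. by move=> f g h; apply: val_inj; exact: mulmxA. Qed.
Lemma SL2_mul1 : left_id SL2_one SL2_mul.
Proof. by move=> g; apply: val_inj; exact: mul1mx. Qed.
Lemma SL2_mulr1 : right_id SL2_one SL2_mul.
Proof. by move=> g; apply: val_inj; exact: mulmx1. Qed.
Lemma SL2_mulV : left_inverse SL2_one SL2_inv SL2_mul.
Proof. by move=> g; apply: val_inj; exact: (mulVmx (SL2_unit g)). Qed.
Lemma SL2_mulrV : right_inverse SL2_one SL2_inv SL2_mul.
Proof. by move=> g; apply: val_inj; exact: (mulmxV (SL2_unit g)). Qed.

HB.instance Definition _ := isGroup.Build (SL2 R)
  SL2_mulA SL2_mul1 SL2_mulr1 SL2_mulV SL2_mulrV.
HB.instance Definition _ := isPointed.Build (SL2 R) SL2_one.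

(* The sigma-algebra generated by the real coordinates of the entries is the
   Borel sigma-algebra of the closed subset SL(2,C) of C^4. *)
Definition coords g : (R * R) * (R * R) * ((R * R) * (R * R)) :=
  let e i j := let z := SL2_mx g i j in (complex.Re z, complex.Im z) in
  (e 0 0, e 0 1, (e 1 0, e 1 1)).

HB.instance Definition _ :=
  Measurable.copy (SL2 R) (g_sigma_algebra_preimageType coords).

End group.

Section coordinates.
Variable R : realType.
Local Notation C := R[i].
Local Notation G := (SL2 R).
Local Notation mR := (measurableTypeR R).

(* The default value 1 of insubd is used below only for a_ r with r <= 0. *)
Definition sl2 (a b c d : C) : G := insubd (1%g : G) (mx2 a b c d).

Definition n_ (z : C) : G := sl2 1 z 0 1.

Definition a_ (r : R) : G := sl2 (Num.sqrt r)%:C 0 0 (Num.sqrt r)^-1%:C.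

Definition SU2 : set G := [set k | (map_mx conjc k)^T *m k = 1%:M].

(* Haar measure on SU(2) of total mass 2, as a measure carried by SU(2). *)
Definition haar_SU2 (dk : set G -> \bar R) : Prop :=
  [/\ dk SU2 = 2%:E, dk (~` SU2) = 0%E &
      forall k A, SU2 k -> measurable A -> dk [set g | A (k * g)%g] = dk A].

Definition iwasawa (p : mR * mR * mR * G) : G :=
  (n_ (p.1.1.1 +i* p.1.1.2) * a_ p.1.2 * p.2)%g.

(* dg = r^-3 dx dy dr dk *)
Definition haar_SL2 (dk : {finite_measure set G -> \bar R}) (A : set G) :
    \bar R :=
  (\int[lebesgue_measure \x lebesgue_measure \x lebesgue_measure \x dk]_(p in
     [set p : mR * mR * mR * G | (0 < p.1.2)%R /\ A (iwasawa p)])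
     (p.1.2 ^- 3)%:E)%E.

Lemma measurable_to_SL2 d (T : measurableType d) (f : T -> G) :
  (forall i j, measurable_fun setT (fun x => complex.Re (SL2_mx (f x) i j))) ->
  (forall i j, measurable_fun setT (fun x => complex.Im (SL2_mx (f x) i j))) ->
  measurable_fun setT f.
Proof.
move=> mRe mIm _ _ [B mB <-]; rewrite setTI setTI.
have mc : measurable_fun setT (@coords R \o f).
  by do ![apply: measurable_fun_pair]; rewrite /=.
by rewrite -comp_preimage -[X in measurable X]setTI; exact: mc.
Qed.

Lemma measurable_coord (i j : 'I_2) :
  measurable_fun setT (fun g : G => complex.Re (SL2_mx g i j)) /\
  measurable_fun setT (fun g : G => complex.Im (SL2_mx g i j)).
Proof.
have mc : measurable_fun setT (@coords R).
  by move=> _ B mB; rewrite setTI; exists B => //; rewrite setTI.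
have m1 d d' (T1 : measurableType d) (T2 : measurableType d') (f : G -> T1 * T2) :
    measurable_fun setT f ->
    measurable_fun setT (fst \o f) /\ measurable_fun setT (snd \o f).
  by move=> /measurable_fun_pairP.
have [/m1[/m1[r00 i00] /m1[r01 i01]] /m1[/m1[r10 i10] /m1[r11 i11]]] := m1 _ _ _ _ _ mc.
have two (k : 'I_2) : k = 0 \/ k = 1.
  by case: k => [[|[|k]]] // ?; [left|right]; exact: val_inj.
by case: (two i) (two j) => -> [] ->; split.
Qed.

Let s (r : R) : R := if 0 < r then r `^ 2^-1 else 1.

Lemma a_E r : SL2_mx (a_ r) = mx2 (s r)%:C 0 0 (s r)^-1%:C.
Proof.
rewrite /s; case: ifPn => r0.
  rewrite powR12_sqrt ?ltW// /a_ /sl2 [LHS]insubdK// -topredE/=.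
  rewrite (expand_det_row _ 0) !big_ord_recr big_ord0/= !mxE/= mul0r addr0 add0r.
  rewrite /cofactor det_mx11 !mxE/= expr0 mul1r -rmorphM/= divff//.
  by rewrite gt_eqF// sqrtr_gt0.
rewrite /a_ /sl2 ler0_sqrtr ?leNgt// invr0 /insubd insubF/=; last first.
  rewrite (expand_det_row _ 0) !big_ord_recr big_ord0/= !mxE/= !mul0r !addr0.
  by rewrite eq_sym oner_eq0.
by apply/matrixP => i j; rewrite !mxE invr1; case: i => [[|[|i]]]//; case: j => [[|[|j]]].
Qed.

Lemma n_E z : SL2_mx (n_ z) = mx2 1 z 0 1.
Proof.
rewrite [LHS]insubdK// -topredE/=.
rewrite (expand_det_row _ 0) !big_ord_recr big_ord0/= !mxE/= mul1r add0r.
by rewrite /cofactor !det_mx11 !mxE/= expr0 mul1r mulr0 mulr0 addr0.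
Qed.

Lemma measurable_iwasawa : measurable_fun setT iwasawa.
Proof.
pose T := (mR * mR * mR * G)%type.
have mx : measurable_fun setT (fun p : T => p.1.1.1) by do ![apply: measurableT_comp => //].
have my : measurable_fun setT (fun p : T => p.1.1.2) by do ![apply: measurableT_comp => //].
have mr : measurable_fun setT (fun p : T => p.1.2) by do ![apply: measurableT_comp => //].
have mpow e : measurable_fun setT (fun r : R => if 0 < r then r `^ e else 1).
  by apply: measurable_fun_ifT => //; exact: measurable_fun_ltr.
have ms : measurable_fun setT (fun p : T => s p.1.2).
  by apply: (measurableT_comp (mpow _)).
have mi : measurable_fun setT (fun p : T => (s p.1.2)^-1).
  rewrite (_ : (fun p : T => _) = (fun r : R => if 0 < r then r `^ (- 2^-1) else 1)
      \o (fun p : T => p.1.2)).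
    exact: (measurableT_comp (mpow _)).
  by apply/funext => p; rewrite /s/=; case: ifP => _; rewrite ?powRN ?invr1.
have mk i j : measurable_fun setT (fun p : T => complex.Re (SL2_mx p.2 i j)).
  exact: (measurableT_comp (measurable_coord i j).1).
have mk' i j : measurable_fun setT (fun p : T => complex.Im (SL2_mx p.2 i j)).
  exact: (measurableT_comp (measurable_coord i j).2).
have E (p : T) (i j : 'I_2) : SL2_mx (iwasawa p) i j =
    if i == 0 then (s p.1.2)%:C * SL2_mx p.2 0 j +
       (p.1.1.1 +i* p.1.1.2) * (s p.1.2)^-1%:C * SL2_mx p.2 1 j
    else (s p.1.2)^-1%:C * SL2_mx p.2 1 j.
  have -> : SL2_mx (iwasawa p) =
      SL2_mx (n_ (p.1.1.1 +i* p.1.1.2)) *m SL2_mx (a_ p.1.2) *m SL2_mx p.2 by [].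
  rewrite n_E a_E !mxE !big_ord_recr big_ord0/= !mxE !big_ord_recr !big_ord0/= !mxE/=.
  have -> : widen_ord (leqnSn 1) ord_max = 0 :> 'I_2 by exact: val_inj.
  have -> : ord_max = 1 :> 'I_2 by exact: val_inj.
  by case: ifP => _; rewrite !(mul0r,mulr0,add0r,addr0,mul1r).
apply: measurable_to_SL2 => i j; under eq_fun do rewrite E;
  case: (i == 0).
- have -> : (fun p : T => complex.Re ((s p.1.2)%:C * SL2_mx p.2 0 j +
       (p.1.1.1 +i* p.1.1.2) * (s p.1.2)^-1%:C * SL2_mx p.2 1 j)) =
     (fun p : T => s p.1.2 * complex.Re (SL2_mx p.2 0 j) +
       (p.1.1.1 * (s p.1.2)^-1 * complex.Re (SL2_mx p.2 1 j)
       - p.1.1.2 * (s p.1.2)^-1 * complex.Im (SL2_mx p.2 1 j))).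
    apply/funext => p; case: (SL2_mx p.2 0 j) => ? ?; case: (SL2_mx p.2 1 j) => ? ?.
    by simpc.
  apply: measurable_funD; first exact: measurable_funM.
  by apply: measurable_funB; apply: measurable_funM => //; exact: measurable_funM.
- have -> : (fun p : T => complex.Re ((s p.1.2)^-1%:C * SL2_mx p.2 1 j)) =
     (fun p : T => (s p.1.2)^-1 * complex.Re (SL2_mx p.2 1 j)).
    by apply/funext => p; case: (SL2_mx p.2 1 j) => ? ?; simpc.
  exact: measurable_funM.
- have -> : (fun p : T => complex.Im ((s p.1.2)%:C * SL2_mx p.2 0 j +
       (p.1.1.1 +i* p.1.1.2) * (s p.1.2)^-1%:C * SL2_mx p.2 1 j)) =
     (fun p : T => s p.1.2 * complex.Im (SL2_mx p.2 0 j) +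
       (p.1.1.1 * (s p.1.2)^-1 * complex.Im (SL2_mx p.2 1 j)
       + p.1.1.2 * (s p.1.2)^-1 * complex.Re (SL2_mx p.2 1 j))).
    apply/funext => p; case: (SL2_mx p.2 0 j) => ? ?; case: (SL2_mx p.2 1 j) => ? ?.
    by simpc.
  apply: measurable_funD; first exact: measurable_funM.
  by apply: measurable_funD; apply: measurable_funM => //; exact: measurable_funM.
- have -> : (fun p : T => complex.Im ((s p.1.2)^-1%:C * SL2_mx p.2 1 j)) =
     (fun p : T => (s p.1.2)^-1 * complex.Im (SL2_mx p.2 1 j)).
    by apply/funext => p; case: (SL2_mx p.2 1 j) => ? ?; simpc.
  exact: measurable_funM.
Qed.

Section haar_measure.
Variable dk : {finite_measure set G -> \bar R}.
Local Open Scope ereal_scope.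
Let T := (mR * mR * mR * G)%type.
Let P : set T := [set p | (0 < p.1.2)%R].
Let S (A : set G) : set T := [set p | (0 < p.1.2)%R /\ A (iwasawa p)].

Let mP : measurable P.
Proof.
have mr : measurable_fun setT (fun p : T => p.1.2) by do ![apply: measurableT_comp => //].
have -> : P = setT `&` (fun p : T => p.1.2) @^-1` `]0%R, +oo[%classic.
  by apply/seteqP; split=> p; rewrite /P /= in_itv/= andbT; [move=> ?|case].
by apply: mr => //; exact: measurable_itv.
Qed.

Let mS A : measurable A -> measurable (S A).
Proof.
move=> mA; rewrite (_ : S A = P `&` (setT `&` iwasawa @^-1` A)).
  by apply: measurableI => //; exact: measurable_iwasawa.
by apply/seteqP; split=> p [p0]; [move=> Ap; split|case].
Qed.

Let mf : measurable_fun P (fun p : T => (p.1.2 ^- 3)%:E).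
Proof.
have mr : measurable_fun setT (fun p : T => p.1.2) by do ![apply: measurableT_comp => //].
apply: (@eq_measurable_fun _ _ _ _ _ (fun p : T => (p.1.2 `^ (- 3%:R))%:E)).
  by move=> p; rewrite inE /P/= => p0; rewrite powR_invn ?ltW.
apply/measurable_EFinP; apply: (measurable_funS _ (@subsetT _ P)) => //.
exact: (measurableT_comp (@measurable_powR R (- 3%:R)) mr).
Qed.

Let haar0 : haar_SL2 dk set0 = 0.
Proof.
rewrite /haar_SL2 (_ : [set p | _] = set0) ?integral_set0//.
by apply/seteqP; split=> p [].
Qed.

Let f_ge0 (p : T) : P p -> 0 <= (p.1.2 ^- 3)%:E.
Proof. by move=> p0; rewrite lee_fin invr_ge0 exprn_ge0// ltW. Qed.

Let haar_ge0 A : 0 <= haar_SL2 dk A.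
Proof. by apply: integral_ge0 => p [/f_ge0]. Qed.

Let haar_sigma_additive : semi_sigma_additive (haar_SL2 dk).
Proof.
move=> F mF tF mUF.
have -> : haar_SL2 dk (\bigcup_n F n) = \sum_(0 <= n <oo) haar_SL2 dk (F n).
  rewrite /haar_SL2 -/(S _) (_ : S _ = \bigcup_n S (F n)); last first.
    apply/seteqP; split=> [p [p0 [n _ ?]]|p [n _ [? ?]]]; first by exists n.
    by split=> //; exists n.
  rewrite ge0_integral_bigcup//.
  - by move=> k; exact: mS.
  - by apply: measurable_funS mf => // p [n _ []].
  - by move=> p [n _ [/f_ge0]].
  - move=> i j _ _ [p [[? ?] [? ?]]]; apply: tF => //.
    by exists (iwasawa p).
by apply: is_cvg_nneseries => n _ _; exact: haar_ge0.
Qed.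

HB.instance Definition _ := isMeasure.Build _ _ _ (haar_SL2 dk)
  haar0 haar_ge0 haar_sigma_additive.

End haar_measure.

End coordinates.
Arguments SU2 {R}.

Section gaussian.
Variable R : realType.
Local Notation C := R[i].
Local Notation G := (SL2 R).

Definition gaussInt : set C :=
  [set z | exists m n : int, z = m%:~R +i* n%:~R].

Definition gaussRat : set C :=
  [set z | exists m n : rat, z = ratr m +i* ratr n].

Definition Gamma0 (q : C) : set G :=
  [set g | (forall i j, gaussInt (g i j)) /\
           exists2 d, gaussInt d & g 1 0 = q * d].

(* The Riemann sphere is [option C], with [None] for the point at infinity. *)
Definition mobius (g : G) (z : option C) : option C :=
  let quot a c := if c == 0 then None else Some (a / c) in
  if z is Some w then quot (g 0 0 * w + g 0 1) (g 1 0 * w + g 1 1)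
  else quot (g 0 0) (g 1 0).

Definition is_cusp (c : option C) : Prop :=
  if c is Some z then gaussRat z else True.

Definition unipotent_stabilizer (Gam : set G) (c : option C) : set G :=
  [set g | [/\ Gam g, mobius g c = c & \tr g = 2%:R]].

Definition scaling_matrices (Gam : set G) (gc : option C -> G) : Prop :=
  gc None = 1%g /\
  forall c, is_cusp c -> mobius (gc c) None = c /\
    [set ((gc c)^-1 * g * gc c)%g | g in unipotent_stabilizer Gam c] =
    [set n_ al | al in gaussInt].

(* Gam acts freely on G (the element -1 included), so uniqueness is exact. *)
Definition fundamental_domain (Gam F : set G) : Prop :=
  measurable F /\
  forall g, exists! gam, Gam gam /\ F (gam * g)%g.

End gaussian.
Arguments gaussInt {R}.

Section hilbert.
Variable R : realType.
Local Notation C := R[i].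
Local Notation G := (SL2 R).
Implicit Types f g : G -> C.

Definition Cintegral d (T : measurableType d)
    (mu : {measure set T -> \bar R})
    (A : set T) (f : T -> C) : C :=
  (\int[mu]_(x in A) complex.Re (f x)) +i* (\int[mu]_(x in A) complex.Im (f x)).

(* [mu] is Haar measure on G, [Gam] the group and [F] its fundamental domain;
   elements of the Hilbert space L^2(Gam\G) are represented by functions, so
   its closed subspaces are sets of functions stable under a.e. equality. *)
Variables (mu : {measure set G -> \bar R}) (Gam F : set G).

Definition normsq f : \bar R := (\int[mu]_(g in F) ((normc (f g)) ^+ 2)%:E)%E.

Definition inner f g : C := Cintegral mu F (fun x => f x * (g x)^*).

Definition L2 : set (G -> C) :=
  [set f | [/\ measurable_fun setT (fun x => complex.Re (f x)),
               measurable_fun setT (fun x => complex.Im (f x)),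
               forall gam x, Gam gam -> f (gam * x)%g = f x &
               (normsq f < +oo)%E]].

Definition L2_closure (A : set (G -> C)) : set (G -> C) :=
  [set f | L2 f /\ forall e : R, 0 < e ->
     exists2 g, A g & (normsq (fun x => f x - g x)%R < e%:E)%E].

Definition lin_span (A : set (G -> C)) : set (G -> C) :=
  [set f | exists n (c : 'I_n -> C) (h : 'I_n -> G -> C),
     (forall i, A (h i)) /\ f = (fun x => \sum_i c i * h i x)].

Definition closed_subspace (V : set (G -> C)) : Prop :=
  [/\ V `<=` L2, lin_span V `<=` V & L2_closure V `<=` V].

Definition right_invariant (V : set (G -> C)) : Prop :=
  forall f h, V f -> V (fun x => f (x * h)%g).

Definition irreducible_subspace (V : set (G -> C)) : Prop :=
  [/\ closed_subspace V, right_invariant V,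
      exists2 f, V f & normsq f != 0%E &
      forall W, closed_subspace W -> right_invariant W -> W `<=` V ->
        W = V \/ forall f, W f -> normsq f = 0%E].

Definition cusp_form (gc : option C -> G) : set (G -> C) :=
  [set f | L2 f /\ forall c, is_cusp c ->
     {ae mu, forall x, Cintegral (@lebesgue_measure R \x @lebesgue_measure R)%E
       (`[0, 1] `*` `[0, 1])
       (fun z => f (gc c * n_ (z.1 +i* z.2) * x)%g) = 0}].

Definition cuspidal_subspace (gc : option C -> G) : set (G -> C) :=
  L2_closure (lin_span (cusp_form gc)).

Definition cuspidal_decomposition (gc : option C -> G)
    (D : set (set (G -> C))) : Prop :=
  [/\ countable D,
      forall V, D V -> irreducible_subspace V,
      forall V W f g, D V -> D W -> V <> W -> V f -> W g -> inner f g = 0 &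
      L2_closure (lin_span (\bigcup_(V in D) V)) = cuspidal_subspace gc].

End hilbert.

Section spectral.
Variable R : realType.
Local Notation C := R[i].
Local Notation G := (SL2 R).

(* Coordinates (x, y, r) on the upper half-space G/K. *)
Definition upper_space : set 'rV[R]_3 := [set p | 0 < p 0 2%:R].

Definition hyp_restr (f : G -> C) (p : 'rV[R]_3) : C :=
  f (n_ (p 0 0 +i* p 0 1) * a_ (p 0 2%:R))%g.

Definition pd (j : 'I_3) (u : 'rV[R]_3 -> R) (p : 'rV[R]_3) : R :=
  'D_(delta_mx 0 j) u p.

Definition C2 (u : 'rV[R]_3 -> R) : Prop :=
  forall p i, upper_space p ->
    [/\ derivable u p (delta_mx 0 i), {for p, continuous (pd i u)} &
        forall j, derivable (pd i u) p (delta_mx 0 j) /\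
                  {for p, continuous (pd j (pd i u))}].

Definition laplacian (u : 'rV[R]_3 -> R) (p : 'rV[R]_3) : R :=
  (p 0 2%:R) ^+ 2 * (\sum_j pd j (pd j u) p) - p 0 2%:R * pd 2%:R u p.

(* The right K-invariant f in V, taken in their smooth representative, with
    -Delta f = lam f; Delta acts on real and imaginary parts. *)
Definition eigenform (V : set (G -> C)) (lam : R) (f : G -> C) : Prop :=
  let u p := complex.Re (hyp_restr f p) in
  let v p := complex.Im (hyp_restr f p) in
  [/\ V f, forall g k, SU2 k -> f (g * k)%g = f g, C2 u, C2 v &
      forall p, upper_space p ->
        - laplacian u p = lam * u p /\ - laplacian v p = lam * v p].

(* Re(nu_V): equal to nu_V when nu_V > 0, and to 0 when nu_V lies on the
   imaginary axis, i.e. when V contains no form of exceptional eigenvalue. *)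
Definition re_nu (V : set (G -> C)) : R :=
  xget 0 [set Num.sqrt (1 - lam) | lam in
    [set lam | 0 < lam < 1 /\ exists2 f, eigenform V lam f & f <> (fun=> 0)]].

(* Only used for s > 0. *)
Definition Euler_Gamma (s : R) : R :=
  \int[lebesgue_measure]_(x in `]0, +oo[) (x `^ (s - 1) * expR (- x)).

Definition cosh (x : R) : R := (expR x + expR (- x)) / 2.

(* Modified Bessel function of the second kind, for x > 0. *)
Definition BesselK (nu x : R) : R :=
  \int[lebesgue_measure]_(t in `[0, +oo[) (expR (- x * cosh t) * cosh (nu * t)).

Definition expi (x : R) : C := cos x +i* sin x.

Definition normalised_form (mu : {measure set G -> \bar R}) (F : set G)
    (V : set (G -> C)) (f : G -> C) : Prop :=
  eigenform V (1 - re_nu V ^+ 2) f /\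
  normsq mu F f =
    (2 * Euler_Gamma (1 - re_nu V) / Euler_Gamma (1 + re_nu V))%:E.

(* unconditional convergence *)
Definition has_csum (S : set C) (u : C -> C) (l : C) : Prop :=
  (\sum_(w <- enum_fset A | w \in S) complex.Re (u w)) @[A --> totally]
    --> complex.Re l /\
  (\sum_(w <- enum_fset A | w \in S) complex.Im (u w)) @[A --> totally]
    --> complex.Im l.

Definition fourier_coefficients (nu : R) (f : G -> C) (c : C -> C) : Prop :=
  forall (z : C) (r : R) (k : G), 0 < r -> SU2 k ->
    has_csum [set w | gaussInt w /\ w != 0]
      (fun w => c w
        * (2 * pi `^ (1 + nu) * normc w `^ nu / Euler_Gamma (1 + nu))%:C
        * expi (2 * pi * complex.Re (w * z))
        * (r * BesselK nu (2 * pi * normc w * r))%:C)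
      (f (n_ z * a_ r * k)%g).

(* c_V(w; nu_V, p_V) for p_V = 0, which nu_V > 0 forces. *)
Definition modified_coefficient (nu : R) (c : C -> C) (w : C) : C :=
  ((pi * normc w) `^ nu)%:C * c w.

(* The function q |-> D q gives the fixed decompositions for Gamma0 q. *)
Variable D : C -> set (set (G -> C)).

(* The maximum is a supremum: only finitely many V have re_nu V <> 0, and
   re_nu takes its values in [0, 1). *)
Definition Theta (q : C) : R := sup [set re_nu V | V in D q].

Definition vartheta : R := sup [set Theta q | q in [set q | gaussInt q /\ q != 0]].

(* Here |n|^(2it) = exp(2 i t log|n|). The sum over V is finite, and is taken
   in the extended reals so that no finiteness has to be assumed. *)
Definition S_t (c : C -> set (G -> C) -> C -> C) (a : C -> C)
    (t Q X N : R) : \bar R :=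
  (\esum_(q in [set q : C | gaussInt q /\ (Q / 2 < normc q ^+ 2 <= Q)%R])
   \esum_(V in [set V : set (G -> C) | D q V /\ (0 < re_nu V)%R])
     (X `^ re_nu V *
      normc (\sum_(n \in [set n : C | gaussInt n /\ (N / 4 < normc n ^+ 2 <= N)%R])
        a n * expi (2 * t * ln (normc n)) *
        modified_coefficient (re_nu V) (c q V) n) ^+ 2)%:E)%R.

End spectral.

(* Main.v *)
Require Import Defs.
From HB Require Import structures.
From mathcomp Require Import all_boot all_order all_algebra.
From mathcomp Require Import all_classical all_reals all_analysis.
From mathcomp Require Import complex.
Import Order.TTheory GRing.Theory Num.Theory.
Import numFieldNormedType.Exports.
Local Open Scope classical_set_scope.
Local Open Scope ring_scope.

(** The inequality holds term by term. The parameter [X] enters [S_t] only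
    through the nonnegative weights [X `^ nu_V], and
    [X `^ nu_V = (X / Y) `^ nu_V * Y `^ nu_V]. If [X <= Y], the first factor is
    at most 1; otherwise it increases with the exponent, and
    [nu_V <= vartheta] by the definition of [vartheta] as a supremum
    ([re_nu_le_vartheta], [powR_le_max]). Summing over [V] and then over [q]
    keeps the common factor ([esumZ_le]).

    A supremum of reals dominates the members of its set only when the set is
    bounded above. The uniform bound [re_nu V <= 1], visible from
    [re_nu V = sqrt (1 - lambda)] with [0 < lambda < 1], makes both [Theta] and
    [vartheta] genuine upper bounds. *)

(** Each finite partial sum on the left is [k] times a partial sum on the right,
    so infinite sums are covered too. *)
Lemma esumZ_le (R : realType) (T : choiceType) (I : set T) (k : R)
    (a : T -> \bar R) :
  0 <= k -> (forall i, I i -> 0 <= a i)%E ->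
  (\esum_(i in I) (k%:E * a i) <= k%:E * \esum_(i in I) a i)%E.
Proof.
move=> k0 a0; apply: ge_ereal_sup => _ [J [finJ JI] <-].
apply: (@le_trans _ _ (k%:E * \sum_(i \in J) a i)%E); last first.
  by apply: lee_wpmul2l => //; apply: ereal_sup_ubound; exists J.
rewrite !fsbig_finite// big_seq [in leRHS]big_seq ge0_sume_distrr// => i.
by rewrite in_fset_set// inE => /JI/a0.
Qed.

(** The power is monotone in the exponent, increasing for [b >= 1] and decreasing
    for [b <= 1]: it is bounded by its value at [y] or at [0] accordingly. *)
Lemma powR_le_max (R : realType) (b x y : R) :
  0 < b -> 0 <= x <= y -> b `^ x <= Num.max 1 (b `^ y).
Proof.
move=> b0 /andP[x0 xy]; rewrite le_max.
have [b1|/ltW b1] := leP b 1; last by rewrite (ler_powR b1 xy) orbT.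
by rewrite -[X in _ <= X](powRr0 b) ger_powR// b0.
Qed.

Lemma re_nu_le1 (R : realType) (V : set (SL2 R -> R[i])) : re_nu V <= 1.
Proof.
rewrite /re_nu; case: xgetP => [_ _ [lam [/andP[lam0 _] _] <-]|_] //.
by rewrite -[leRHS]sqrtr1 ler_wsqrtr// lerBlDr lerDl ltW.
Qed.

Section suprema.
Context (R : realType) (D : R[i] -> set (set (SL2 R -> R[i]))).

Lemma re_nu_le_Theta q V : D q V -> re_nu V <= Theta D q.
Proof.
move=> DV; apply: ub_le_sup; last by exists V.
by exists 1 => _ [W _ <-]; exact: re_nu_le1.
Qed.

(** When [D q] is empty, [Theta D q] is the supremum of the empty set, which is
    [0]. *)
Lemma Theta_le1 q : Theta D q <= 1.
Proof.
have [D0|/set0P D0] := eqVneq (D q) set0.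
  by rewrite /Theta D0 image_set0 sup0.
apply: ge_sup; first exact/image_nonempty.
by move=> _ [W _ <-]; exact: re_nu_le1.
Qed.

Lemma re_nu_le_vartheta q V :
  gaussInt q -> q != 0 -> D q V -> re_nu V <= vartheta D.
Proof.
move=> gq q0 /re_nu_le_Theta/le_trans; apply.
apply: ub_le_sup; last by exists q.
by exists 1 => _ [p _ <-]; exact: Theta_le1.
Qed.

End suprema.

Theorem theorem6 (R : realType)
  (dk : {finite_measure set (SL2 R) -> \bar R}) (hdk : haar_SU2 dk)
  (F : R[i] -> set (SL2 R))
  (hF : forall q, gaussInt q -> q != 0 -> fundamental_domain (Gamma0 q) (F q))
  (gc : R[i] -> option R[i] -> SL2 R)
  (hgc : forall q, gaussInt q -> q != 0 -> scaling_matrices (Gamma0 q) (gc q))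
  (D : R[i] -> set (set (SL2 R -> R[i])))
  (hD : forall q, gaussInt q -> q != 0 ->
     cuspidal_decomposition (haar_SL2 dk) (Gamma0 q) (F q) (gc q) (D q))
  (f : R[i] -> set (SL2 R -> R[i]) -> SL2 R -> R[i])
  (hf : forall q V, gaussInt q -> q != 0 -> D q V -> 0 < re_nu V ->
     normalised_form (haar_SL2 dk) (F q) V (f q V))
  (c : R[i] -> set (SL2 R -> R[i]) -> R[i] -> R[i])
  (hc : forall q V, gaussInt q -> q != 0 -> D q V -> 0 < re_nu V ->
     fourier_coefficients (re_nu V) (f q V) (c q V))
  (a : R[i] -> R[i]) (X Y Q N t : R) :
  1 <= X -> 1 <= Y -> 0 < Q -> 0 < N ->
  (S_t D c a t Q X N
     <= (Num.max 1 ((X / Y) `^ vartheta D))%:E * S_t D c a t Q Y N)%E.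
Proof.
move=> X1 Y1 Q0 _.
have X0 : 0 < X by exact: lt_le_trans X1.
have Y0 : 0 < Y by exact: lt_le_trans Y1.
set M := Num.max _ _.
have M0 : 0 <= M by rewrite le_max ler01.
apply: le_trans (esumZ_le _ _ _ _ _ M0 _); last first.
  move=> q _; apply: esum_ge0 => V _.
  by rewrite lee_fin mulr_ge0 ?powR_ge0 ?sqr_ge0.
apply: le_esum => q [gq /andP[Qq _]].
have q0 : q != 0.
  apply: contraTneq Qq => ->; rewrite Normc.normc0 expr0n/= -leNgt.
  by rewrite divr_ge0// ltW.
apply: le_trans (esumZ_le _ _ _ _ _ M0 _); last first.
  by move=> V _; rewrite lee_fin mulr_ge0 ?powR_ge0 ?sqr_ge0.
apply: le_esum => V [DV nu0].
rewrite -EFinM lee_fin [leRHS]mulrA ler_wpM2r ?sqr_ge0//.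
have -> : X `^ re_nu V = (X / Y) `^ re_nu V * Y `^ re_nu V.
  by rewrite -powRM ?divfK ?gt_eqF// ltW ?divr_gt0.
rewrite ler_wpM2r ?powR_ge0// powR_le_max ?divr_gt0// ltW//=.
exact: (re_nu_le_vartheta _ _ _ _ gq).
Qed.
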